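(* The following statements are true. (i) Let $X$ be a Banach space with the pseudo-Daugavet property. Then there is no Schauder-Orlicz decomposition $\{\mathfrak{M}_n\}_{n=0}^{\infty}$ of $X$ such that at least one of the subspaces $\mathfrak{M}_n$ is finite dimensional. (ii) Conversely, let $X$ be a Banach space with a Schauder-Orlicz decomposition at least one subspace of which is finite dimensional. Then $X$ does not have the pseudo-Daugavet property.
   Context: A Schauder decomposition of a Banach space $X$ is a sequence $\{\mathfrak{M}_n\}_{n=0}^{\infty}$ of closed nonzero linear subspaces of $X$ such that each $x\in X$ has a unique norm convergent expansion $x=\sum_{n=0}^{\infty}x_n$ with $x_n\in\mathfrak{M}_n$ for all $n$. Its associated sequence of coordinate projections (a.s.c.p.) $\{P_n\}_{n=0}^{\infty}$ is defined by $P_nx=x_n$; each $P_n$ is bounded. An Orlicz function is a continuous, nondecreasing, convex function $\Phi:[0,\infty)\to[0,\infty)$ with $\Phi(0)=0$ and $\lim_{t\to\infty}\Phi(t)=\infty$ (it may be degenerate, i.e. $\Phi(t)=0$ for some $t>0$). A Schauder decomposition of $X$ with a.s.c.p. $\{P_n\}$ is a Schauder-Orlicz decomposition (with Orlicz function $\Phi$) if there exists an Orlicz function $\Phi$ such that for every $x\in X$: $\inf\{\rho>0:\sum_{n=0}^{\infty}\Phi(\|P_nx\|/\rho)\le 1\}=\|x\|$. A Banach space $X$ has the pseudo-Daugavet property if there exists a strictly increasing function $\varphi_X:(0,\infty)\to(0,\infty)$ such that $\|I+K\|\ge 1+\varphi_X(\|K\|)$ for every nonzero compact linear operator $K$ on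 $X$. *)

(* Defs.v *)
From HB Require Import structures.
From mathcomp Require Import all_boot all_order all_algebra.
From mathcomp Require Import all_classical all_reals all_analysis.
From mathcomp Require Import complex.
Set Implicit Arguments.
Unset Strict Implicit.
Unset Printing Implicit Defensive.
Import Order.TTheory GRing.Theory Num.Theory.
Import numFieldNormedType.Exports.
Local Open Scope classical_set_scope.
Local Open Scope ring_scope.

(* Banach spaces may be real or complex. *)
Variant scalars := real_scalars | complex_scalars.

Definition scalar_field (R : realType) (s : scalars) : numFieldType :=
  match s with
  | real_scalars => R
  | complex_scalars => R[i]
  end.

Definition scalar_re (R : realType) (s : scalars) : scalar_field R s -> R :=
  match s return scalar_field R s -> R with
  | real_scalars => fun a => a
  | complex_scalars => @complex.Re R
  end.

(* The norm of a [normedModType K] takes its values in [K]; over the complex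
   numbers these values have a null imaginary part, so that taking the real
   part loses nothing and yields the usual real-valued norm. *)
Definition rnorm (R : realType) (s : scalars)
    (X : normedModType (scalar_field R s)) (x : X) : R :=
  scalar_re `|x|.

Section Decompositions.
Context {R : realType} {s : scalars}.
Local Notation K := (scalar_field R s).
Implicit Type X : completeNormedModType K.

Definition is_expansion X (M : nat -> set X) (x : X) (u : nat -> X) : Prop :=
  (forall n, M n (u n)) /\ series u @ \oo --> x.

Definition schauder_decomposition X (M : nat -> set X) : Prop :=
  (forall n, [/\ closed (M n), submod_closed [in M n]
               & exists2 x, M n x & x != 0]) /\
  (forall x, exists! u : nat -> X, is_expansion M x u).

(* For a Schauder decomposition [M], this determines [P]. *)
Definition is_ascp X (M : nat -> set X) (P : nat -> X -> X) : Prop :=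
  forall x, is_expansion M x (fun n => P n x).

(* An Orlicz function is a total function on [R] of which only the restriction
   to the nonnegative reals matters. *)
Definition orlicz_function (Phi : R -> R) : Prop :=
  [/\ {within `[0, +oo[, continuous Phi},
      {in `[0, +oo[ &, {homo Phi : a b / a <= b}},
      @convex_function R R^o `[0, +oo[ Phi,
      (forall t, 0 <= t -> 0 <= Phi t) /\ Phi 0 = 0
    & Phi t @[t --> +oo] --> +oo].

(* The infimum is taken in the extended reals, where that of the empty set
   is [+oo]. *)
Definition schauder_orlicz_decomposition X (M : nat -> set X) : Prop :=
  schauder_decomposition M /\
  exists P : nat -> X -> X, is_ascp M P /\
  exists Phi : R -> R, orlicz_function Phi /\
  forall x : X,
    ereal_inf [set rho%:E | rho in
        [set rho : R | 0 < rho /\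
          (\sum_(0 <= n <oo) (Phi (rnorm (P n x) / rho))%:E <= 1)%E]]
    = (rnorm x)%:E.

Definition finite_dimensional X (A : set X) : Prop :=
  exists (d : nat) (v : 'I_d -> X),
    A = [set x | exists c : 'I_d -> K, x = \sum_i c i *: v i].

Definition compact_operator X (T : {linear X -> X}) : Prop :=
  precompact (T @` [set x | rnorm x <= 1]).

(* [sup] is the real supremum, meaningful when [T] is bounded; this is the case
   of [T] and [id + T] for [T] a compact operator. *)
Definition op_norm X (T : X -> X) : R :=
  sup [set rnorm (T x) | x in [set x | rnorm x <= 1]].

Definition pseudo_daugavet X : Prop :=
  exists phi : R -> R,
    [/\ forall t, 0 < t -> 0 < phi t,
        forall a b, 0 < a -> a < b -> phi a < phi b
      & forall T : {linear X -> X}, compact_operator T ->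
          (exists x, T x != 0) ->
          1 + phi (op_norm T) <= op_norm (fun x => x + T x)].

End Decompositions.

(* Main.v *)
From HB Require Import structures.
Require Import Defs.
From mathcomp Require Import all_boot all_order all_algebra.
From mathcomp Require Import all_classical all_reals all_analysis.
From mathcomp Require Import complex.
Set Implicit Arguments.
Unset Strict Implicit.
Unset Printing Implicit Defensive.
Import Order.TTheory GRing.Theory Num.Theory.
Import numFieldNormedType.Exports.
Local Open Scope classical_set_scope.
Local Open Scope ring_scope.

(** Both parts say that a space carrying a Schauder-Orlicz decomposition with a
    finite-dimensional term [M n] cannot have the pseudo-Daugavet property; the
    operator that witnesses this is [T = - P n].

    The coordinates of [x - P n x] are those of [x], except that the [n]-th one
    has been replaced by [0] ([ascp_remainder]).  As an Orlicz function is
    nonnegative and vanishes at [0], every [rho] admissible in the Luxemburg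
    infimum for [x] is admissible for [x - P n x], so [id + T] is a contraction
    ([orlicz_remainder_le]) and its operator norm is at most [1].  The operator
    [T] is linear because expansions are unique, is nonzero because [M n] is,
    and maps the unit ball into the ball of radius [2], since
    [P n x = x - (x - P n x)].  Once [T] is known to be compact, the
    pseudo-Daugavet inequality would give [1 + phi (op_norm T) <= 1] with
    [op_norm T > 0], contradicting the positivity of [phi].

    Compactness of [T] is the Heine-Borel property of finite-dimensional
    subspaces ([compact_balls_span]), over real or complex scalars.  It is
    proved by adding one spanning vector [v] at a time to a subspace [V] that
    already has it: if [v] is outside [V], it is at a positive distance [d] from
    [V], so that [`|x + a *: v| <= r] bounds [`|a|] by [r / d], and then
    bounds [x]. *)

(** * Compact balls in finite-dimensional subspaces *)

(** A Heine-Borel property of a subset [V], with a compact set inserted between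
    each ball of [V] and [V] rather than compactness of the ball itself: in this
    form it passes to images under continuous maps, and the closedness of [V]
    is a consequence of it. *)
Definition compact_balls (K : numFieldType) (X : normedModType K) (V : set X) :=
  forall r : K, exists B : set X,
    [/\ compact B, [set x | V x /\ `|x| <= r] `<=` B & B `<=` V].

Lemma compact_balls_span0 (K : numFieldType) (X : normedModType K) :
  compact_balls [set 0 : X].
Proof.
by move=> r; exists [set 0]; split=> [|x []//|//]; exact: compact_set1.
Qed.

(** Otherwise [v] would be a limit of points of [V] of norm at most
    [`|v| + 1]; these lie in a compact, hence closed, subset of [V]. *)
Lemma compact_balls_dist (K : numFieldType) (X : normedModType K) (V : set X)
    (v : X) : compact_balls V -> ~ V v ->
  exists2 d : K, 0 < d & forall y, V y -> d <= `|v - y|.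
Proof.
move=> cV Vv; apply: contrapT => nd; apply: Vv.
have [B [cB VB BV]] := cV (`|v| + 1); apply: BV.
have clB : closed B by apply: compact_closed cB; exact: norm_hausdorff.
apply: clB => A /nbhs_ballP[e /= e0 veA].
have e1 : (e >=< 1)%O by rewrite real_comparable ?gtr0_real.
set e' := Num.min e 1.
have e'0 : 0 < e' by rewrite comparable_lt_min// e0 ltr01.
have [y [Vy vy]] : exists y, V y /\ `|v - y| < e'.
  apply: contrapT => ny; apply: nd; exists e' => // y Vy.
  rewrite real_leNgt ?normr_real ?gtr0_real//.
  by apply/negP => vy; apply: ny; exists y.
move: vy; rewrite comparable_lt_min// => /andP[vye vy1].
exists y; split; last by apply: veA; rewrite -ball_normE.
apply: VB; split => //; rewrite -[y](subrK v).
by rewrite (le_trans (ler_normD _ _))// addrC lerD2l distrC ltW.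
Qed.

(** This is the inductive step. The scalars are taken in [K^o] so that the
    same property expresses that [K] itself is locally compact. *)
Lemma compact_balls_add_line (K : numFieldType) (X : normedModType K)
    (V : set X) (v : X) :
  compact_balls [set: K^o] ->
  submod_closed [in V] -> compact_balls V ->
  compact_balls [set x.1 + x.2 *: v | x in V `*` [set: K]].
Proof.
move=> cK [V0 VP] cV; set W := (X in compact_balls X).
have VD x (a : K) y : V x -> V y -> V (a *: x + y).
  move=> Vx Vy; apply/set_mem; exact: (VP a x y (mem_set Vx) (mem_set Vy)).
have [Vv|nVv] := pselect (V v).
  suff -> : W = V by [].
  apply/seteqP; split => [_ [[x a] [/= Vx _] <-]|x Vx].
    by rewrite addrC; exact: VD.
  by exists (x, 0) => //=; rewrite scale0r addr0.
have [d d0 dP] := compact_balls_dist cV nVv.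
move=> r.
(* If [`|x + a *: v| <= r] then [`|a| <= r / d], whence
   [`|x| <= r + r / d * `|v|]. *)
have [B [cB VB BV]] := cV (r + r / d * `|v|).
have [D [cD rD _]] := cK (r / d).
exists [set x.1 + x.2 *: v | x in B `*` D]; split.
- apply: continuous_compact; last exact: compact_setX.
  apply: continuous_subspaceT => -[x a] /=.
  by apply: cvgD; [exact: cvg_fst|apply: cvgZr_tmp; exact: cvg_snd].
- move=> _ [[[x a] [/= Vx _] <-] xr].
  have ar : `|a| <= r / d.
    rewrite ler_pdivlMr// (le_trans _ xr)//.
    have [->|a0] := eqVneq a 0; first by rewrite normr0 mul0r.
    have -> : x + a *: v = a *: (v - (- a^-1 *: x)).
      by rewrite scaleNr opprK scalerDr scalerA divff// scale1r addrC.
    rewrite normrZ ler_wpM2l//; apply: dP.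
    by rewrite -[_ *: x]addr0; apply: VD => //; exact/set_mem.
  exists (x, a) => //; split => /=; last exact: rD.
  apply: VB; split => //.
  rewrite -[x](addrK (a *: v)) (le_trans (ler_normB _ _))// lerD//.
  by rewrite normrZ ler_wpM2r.
- by move=> _ [[x a] [/= /BV Vx _] <-]; exists (x, a).
Qed.

Definition span_of (K : numFieldType) (X : normedModType K) d (v : 'I_d -> X) :=
  [set x : X | exists c : 'I_d -> K, x = \sum_i c i *: v i].

Lemma submod_closed_span (K : numFieldType) (X : normedModType K) d
  (v : 'I_d -> X) : submod_closed [in span_of v].
Proof.
split=> [|a x y].
  rewrite inE; exists (fun=> 0); rewrite big1// => i _; exact: scale0r.
rewrite !inE => -[c ->] [c' ->]; exists (fun i => a * c i + c' i).
rewrite scaler_sumr -big_split; apply: eq_bigr => i _ /=.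
by rewrite scalerDl scalerA.
Qed.

Lemma compact_balls_span (K : numFieldType) (X : normedModType K) d
    (v : 'I_d -> X) :
  compact_balls [set: K^o] -> compact_balls (span_of v).
Proof.
move=> cK; elim: d v => [v|d IH v].
  suff -> : span_of v = [set 0] by exact: compact_balls_span0.
  apply/seteqP; split => [x [c ->]|x ->]; first by rewrite big_ord0.
  by exists (fun=> 0); rewrite big_ord0.
pose v' i := v (widen_ord (leqnSn d) i).
suff -> : span_of v =
    [set x.1 + x.2 *: v ord_max | x in span_of v' `*` [set: K]].
  by apply: compact_balls_add_line => //; exact: submod_closed_span.
apply/seteqP; split => [x [c ->]|_ [[_ a] [/= [c ->] _] <-]].
  rewrite big_ord_recr.
  exists (\sum_i c (widen_ord (leqnSn d) i) *: v' i, c ord_max) => //.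
  by split => //; exists (fun i => c (widen_ord (leqnSn d) i)).
exists (fun i => oapp c a (unlift ord_max i)).
rewrite big_ord_recr /= unlift_none /=; congr (_ + _); apply: eq_bigr => i _.
have -> : widen_ord (leqnSn d) i = lift ord_max i.
  by apply: val_inj; rewrite /= /bump leqNgt ltn_ord.
rewrite liftK /= /v'; congr (_ *: v _).
by apply: val_inj; rewrite /= /bump leqNgt ltn_ord.
Qed.

(** The topology of [R[i]] comes from its modulus, so the continuity of
    [(a, b) |-> a + i b] from the product topology of [R * R] has to be checked;
    a disc is then covered by the image of a square. *)
Lemma compact_balls_complex (R : realType) :
  compact_balls [set: (R[i] : numFieldType)^o].
Proof.
pose f (p : R * R) : (R[i] : numFieldType) := (p.1 +i* p.2)%C.
have fN p : `|f p| <= (`|p.1| + `|p.2|)%:C%C.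
  rewrite [f p]complexE rmorphD; apply: le_trans (ler_normD _ _) _.
  rewrite normrM !normc_def /= !(expr0n, addr0, add0r, expr1n).
  by rewrite sqrtr1 mul1r !sqrtr_sqr.
have cf : continuous f.
  move=> p; apply/cvgrPdist_lt => e e0.
  have er : e \is Num.real by exact: gtr0_real.
  have e'0 : 0 < complex.Re e by rewrite -ltcR RRe_real.
  near=> t; rewrite (_ : f p - f t = f (p - t)); last first.
    by rewrite /f /=; simpc.
  rewrite (le_lt_trans (fN _))// -(RRe_real er) ltcR.
  rewrite [ltRHS]splitr ltrD//.
  - near: t; apply: (@cvgr_dist_lt _ _ _ _ _ fst p.1); last by rewrite divr_gt0.
    exact: cvg_fst.
  - near: t; apply: (@cvgr_dist_lt _ _ _ _ _ snd p.2); last by rewrite divr_gt0.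
    exact: cvg_snd.
move=> r; set q := complex.Re r.
exists (f @` (`[- q, q] `*` `[- q, q])).
split => //.
- apply: continuous_compact; first exact: continuous_subspaceT.
  by apply: compact_setX; exact: segment_compact.
- move=> a /= [_ ar]; exists (complex.Re a, complex.Im a); last by case: a {ar}.
  have rr : r \is Num.real by rewrite -(ler_real ar) normr_real.
  rewrite /= !in_itv /= -!ler_norml.
  split; rewrite -lecR (RRe_real rr) (le_trans _ ar)//.
    exact: normc_ge_Re.
  by rewrite normc_def lecR -sqrtr_sqr ler_wsqrtr// lerDr sqr_ge0.
Unshelve. all: by end_near. Qed.

Lemma compact_balls_scalar_field (R : realType) s :
  compact_balls [set: (scalar_field R s)^o].
Proof.
case: s => /=; last exact: compact_balls_complex.
move=> r; exists `[- r, r]%classic; split => //; first exact: segment_compact.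
by move=> a [_]; rewrite /= in_itv /= ler_norml.
Qed.

(** * The real-valued norm *)

Section scalar_re.
Context {R : realType} {s : scalars}.
Local Notation K := (scalar_field R s).
Implicit Types a b : K.

Lemma scalar_reD a b : scalar_re (a + b) = scalar_re a + scalar_re b.
Proof. by case: s a b => // -[? ?] [? ?]. Qed.

Lemma scalar_re0 : scalar_re (0 : K) = 0.
Proof. by case: s. Qed.

Lemma scalar_re1 : scalar_re (1 : K) = 1.
Proof. by case: s. Qed.

Lemma scalar_re_nat n : scalar_re (n%:R : K) = n%:R.
Proof.
elim: n => [|n IH]; first exact: scalar_re0.
by rewrite !mulrS scalar_reD scalar_re1 IH.
Qed.

Lemma scalar_re_le a b : 0 <= a -> 0 <= b ->
  (scalar_re a <= scalar_re b) = (a <= b).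
Proof.
case: s a b => //= -[a a'] [b b']; rewrite !lecE /=.
by move=> /andP[/eqP-> _] /andP[/eqP-> _]; rewrite eqxx.
Qed.

End scalar_re.

Section rnorm.
Context {R : realType} {s : scalars} {X : normedModType (scalar_field R s)}.
Implicit Types x y : X.

Lemma rnorm_le_norm x y : (rnorm x <= rnorm y) = (`|x| <= `|y|).
Proof. by rewrite /rnorm scalar_re_le. Qed.

Lemma rnorm0 : rnorm (0 : X) = 0.
Proof. by rewrite /rnorm normr0 scalar_re0. Qed.

Lemma rnorm_ge0 x : 0 <= rnorm x.
Proof. by rewrite -rnorm0 rnorm_le_norm normr0. Qed.

Lemma rnorm_gt0 x : x != 0 -> 0 < rnorm x.
Proof. by move=> x0; rewrite -rnorm0 ltNge rnorm_le_norm normr0 normr_le0. Qed.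

Lemma rnormN x : rnorm (- x) = rnorm x.
Proof. by rewrite /rnorm normrN. Qed.

Lemma ler_rnormD x y : rnorm (x + y) <= rnorm x + rnorm y.
Proof. by rewrite /rnorm -scalar_reD scalar_re_le ?addr_ge0// ler_normD. Qed.

End rnorm.

(** * Operator norms and compact operators *)

Section operators.
Context {R : realType} {s : scalars}.
Context {X : completeNormedModType (scalar_field R s)}.

Lemma op_norm_le (T : X -> X) (c : R) :
  (forall x, rnorm x <= 1 -> rnorm (T x) <= c) -> op_norm T <= c.
Proof.
move=> Tc; apply: ge_sup; last by move=> _ [x /= x1 <-]; exact: Tc.
by exists (rnorm (T 0)), 0 => //=; rewrite rnorm0.
Qed.

(** The bound [c] is what makes the supremum defining [op_norm T]
    meaningful. *)
Lemma op_norm_gt0 (T : {linear X -> X}) (c : R) :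
  (forall x, rnorm x <= 1 -> rnorm (T x) <= c) ->
  (exists x, T x != 0) -> 0 < op_norm T.
Proof.
move=> Tc [x Tx]; have x0 : x != 0.
  by apply: contra_neq Tx => ->; exact: raddf0.
have nx0 : `|x|^-1 != 0 by rewrite invr_eq0 normr_eq0.
apply: (@lt_le_trans _ _ (rnorm (T (`|x|^-1 *: x)))).
  by rewrite rnorm_gt0// linearZ scaler_eq0 negb_or nx0.
apply: ub_le_sup; first by exists c => _ [y /= y1 <-]; exact: Tc.
exists (`|x|^-1 *: x) => //=; rewrite /rnorm normrZ normfV normr_id.
by rewrite mulVf ?normr_eq0// scalar_re1.
Qed.

Lemma compact_operator_finite_rank (T : {linear X -> X}) d (v : 'I_d -> X)
    (c : R) :
  (forall x, span_of v (T x)) ->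
  (forall x, rnorm x <= 1 -> rnorm (T x) <= c) -> compact_operator T.
Proof.
move=> vT Tc.
(* The radius has to be a scalar, so [c] is replaced by a natural number. *)
pose r := Num.bound `|c|.
have cr : c <= r%:R.
  by rewrite (le_trans (ler_norm _))// ltW// archi_boundP.
have [B [cB vB _]] :=
  compact_balls_span v (@compact_balls_scalar_field R s) r%:R.
exists B; last by split=> //; apply: compact_closed cB; exact: norm_hausdorff.
move=> _ [x /= x1 <-]; apply: vB; split => //=.
by rewrite -scalar_re_le// scalar_re_nat (le_trans (Tc _ x1)).
Qed.

End operators.

(** * Coordinate projections of a Schauder decomposition *)

Section expansions.
Context {R : realType} {s : scalars}.
Context {X : completeNormedModType (scalar_field R s)}.
Variables (M : nat -> set X) (sM : schauder_decomposition M).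

Lemma expansion_linear a x y u w : is_expansion M x u -> is_expansion M y w ->
  is_expansion M (a *: x + y) (fun n => a *: u n + w n).
Proof.
move=> [Mu ux] [Mw wy]; split=> [n|].
  have [_ [_ Mlin] _] := sM.1 n.
  exact/set_mem/(Mlin a _ _ (mem_set (Mu n)) (mem_set (Mw n))).
rewrite (_ : series _ = (fun n => a *: series u n + series w n)); last first.
  by apply/funext => n; rewrite /series /= scaler_sumr -big_split.
by apply: cvgD => //; exact: cvgZl_tmp.
Qed.

Lemma expansion_single n z : M n z ->
  is_expansion M z (fun m => if m == n then z else 0).
Proof.
move=> Mz; split=> [m|].
  have [_ [M0 _] _] := sM.1 m; case: eqP => [->//|_]; exact: set_mem.
apply: cvg_near_cst; exists n.+1 => // m /= nm.
by rewrite /series /= -big_mkcond big_nat1_eq /= nm.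
Qed.

Variables (P : nat -> X -> X) (PP : is_ascp M P).

Lemma ascpE x u : is_expansion M x u -> forall n, P n x = u n.
Proof.
move=> ux n; have [w [_ w_uniq]] := sM.2 x.
by rewrite -(w_uniq _ ux) (w_uniq _ (PP x)).
Qed.

Lemma ascp_linear n : linear (P n).
Proof. move=> a x y; exact: (ascpE (expansion_linear a (PP x) (PP y))). Qed.

Lemma ascp_single n z : M n z -> forall m, P m z = if m == n then z else 0.
Proof. by move=> /expansion_single /ascpE. Qed.

(** By linearity and [ascp_single], as [P n x] is its own expansion. *)
Lemma ascp_remainder n x m : P m (x - P n x) = if m == n then 0 else P m x.
Proof.
have Mnx : M n (P n x) by exact: (PP x).1.
rewrite addrC -scaleN1r ascp_linear (ascp_single Mnx) scaleN1r.
by case: eqP => [->|_]; rewrite ?addNr// oppr0 add0r.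
Qed.

(** The Luxemburg norm can only decrease when a coordinate is set to [0]:
    no term of [\sum_m Phi (rnorm (P m x) / rho)] increases, for any [rho]. *)
Lemma orlicz_remainder_le (Phi : R -> R) n x : orlicz_function Phi ->
  (forall x : X,
    ereal_inf [set rho%:E | rho in
        [set rho : R | 0 < rho /\
          (\sum_(0 <= n <oo) (Phi (rnorm (P n x) / rho))%:E <= 1)%E]]
    = (rnorm x)%:E) ->
  rnorm (x - P n x) <= rnorm x.
Proof.
move=> [_ _ _ [Phi0 Phi00] _] PhiP; rewrite -lee_fin -!PhiP.
apply: ereal_inf_le_tmp => _ [rho [rho0 xrho] <-]; exists rho => //; split=> //.
apply: le_trans xrho; apply: lee_nneseries => m *.
  by rewrite lee_fin Phi0// divr_ge0 ?rnorm_ge0 ?ltW.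
rewrite lee_fin ascp_remainder; case: eqP => // _.
by rewrite rnorm0 mul0r Phi00 Phi0// divr_ge0 ?rnorm_ge0 ?ltW.
Qed.

End expansions.

(** * Incompatibility with the pseudo-Daugavet property *)

(** The pseudo-Daugavet inequality fails for [- P n]. *)
Lemma schauder_orlicz_not_pseudo_daugavet (R : realType) (s : scalars)
    (X : completeNormedModType (scalar_field R s)) (M : nat -> set X) n :
  schauder_orlicz_decomposition M -> finite_dimensional (M n) ->
  ~ pseudo_daugavet X.
Proof.
move=> [sM [P [PP [Phi [oPhi PhiP]]]]] [d [v Mv]] [phi [phi0 _ phiT]].
have PB x : rnorm (x - P n x) <= rnorm x.
  exact: (orlicz_remainder_le sM PP n x oPhi PhiP).
have fL : linear (fun x => - P n x).
  by move=> a x y; rewrite (ascp_linear sM PP) opprD scalerN.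
pose T : {linear X -> X} :=
  HB.pack (fun x => - P n x) (GRing.isLinear.Build _ X X _ _ fL).
have TE x : T x = - P n x by [].
have T2 x : rnorm x <= 1 -> rnorm (T x) <= 2.
  move=> x1; rewrite TE -[- P n x](addKr x).
  rewrite (le_trans (ler_rnormD _ _))// rnormN -[2]/(1 + 1) lerD//.
  by rewrite (le_trans (PB x)).
have Tn0 : exists x, T x != 0.
  have [_ _ [z Mz z0]] := sM.1 n; exists z.
  by rewrite TE (ascp_single sM PP Mz) eqxx oppr_eq0.
have cT : compact_operator T.
  apply: (compact_operator_finite_rank (v := v) _ T2) => // x.
  apply/set_mem.
  have [M0 MP] := submod_closed_span v.
  rewrite TE -[- _]addr0 -scaleN1r; apply: MP => //.
  rewrite inE /span_of -Mv; exact: (PP x).1.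
have := phiT T cT Tn0; apply/negP; rewrite -ltNge.
apply: (@le_lt_trans _ _ 1); last by rewrite ltrDl phi0// (op_norm_gt0 T2).
by apply: op_norm_le => x; apply: le_trans; rewrite TE.
Qed.

Theorem theorem30 (R : realType) (s : scalars) :
  (forall X : completeNormedModType (scalar_field R s),
     pseudo_daugavet X ->
     ~ exists M : nat -> set X,
         schauder_orlicz_decomposition M /\
         exists n, finite_dimensional (M n)) /\
  (forall X : completeNormedModType (scalar_field R s),
     (exists M : nat -> set X,
        schauder_orlicz_decomposition M /\
        exists n, finite_dimensional (M n)) ->
     ~ pseudo_daugavet X).
Proof.
split=> X; last first.
  by move=> [M [soM [n fn]]]; exact: schauder_orlicz_not_pseudo_daugavet soM fn.
move=> pX [M [soM [n fn]]].
exact: (schauder_orlicz_not_pseudo_daugavet soM fn pX).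
Qed.
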